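(* Let $q=3^m$ with $m\ge 1$, and let $n\ge 2$. Then $$N_q(n,n;1)=q^{\dim_{\mathbb F_q}R_q(n,n)-1},$$ where $$\dim_{\mathbb F_q}R_q(n,n)=\sum_{0\le j\le\lfloor n/q\rfloor}(-1)^j\binom nj\binom{2n-qj}n.$$
   Context: For a prime power $q=p^m$ ($p$ prime) and integers $n>0$, $0\le d\le n(q-1)$, the $q$-ary Reed-Muller code is $$R_q(d,n)=\{f\in\mathbb F_q[X_1,\dots,X_n]:\deg f\le d,\ \deg_{X_j}f\le q-1 \text{ for } 1\le j\le n\},$$ where $\deg$ is the total degree and $\deg_{X_j}$ is the degree in $X_j$ (the zero polynomial is included). The weight of $f\in R_q(d,n)$ is $|f|=q^n-|Z(f)|$, where $Z(f)=\{\boldsymbol x\in\mathbb F_q^n:f(\boldsymbol x)=0\}$. For $t\ge 0$, $N_q(d,n;t)=|\{f\in R_q(d,n):\nu_p(|f|)\ge t\}|$, where $\nu_p$ is the $p$-adic valuation ($\nu_p(0)=\infty$); that is, the number of codewords with weight divisible by $p^t$. *)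

(* Defs.v *)
From HB Require Import structures.
From mathcomp Require Import all_boot all_order all_algebra.
From mathcomp Require Import mpoly.

Set Implicit Arguments.
Unset Strict Implicit.
Unset Printing Implicit Defensive.

Import GRing.Theory.
Local Open Scope ring_scope.

Definition mdegX (R : nzRingType) (n : nat) (j : 'I_n) (f : {mpoly R[n]}) : nat :=
  \max_(m <- msupp f) m j.

(* [msize f] is 1 + deg f, and 0 for the zero polynomial. *)
Definition is_reed_muller (F : finFieldType) (d n : nat) : pred {mpoly F[n]} :=
  fun f => (msize f <= d.+1)%N && [forall j, mdegX j f <= #|F|.-1]%N.
Arguments is_reed_muller : clear implicits.

Record reed_muller (F : finFieldType) (d n : nat) := ReedMuller {
  mpoly_of_rm :> {mpoly F[n]};
  _ : is_reed_muller F d n mpoly_of_rm }.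

(* The F-vector space structure of R_q(d, n) is the one induced by {mpoly F[n]};
   the monomials it contains give the coordinates showing that it is
   finite-dimensional, hence also finite. *)
Section ReedMullerVector.
Variables (F : finFieldType) (d n : nat).

HB.instance Definition _ := [isSub for @mpoly_of_rm F d n].
HB.instance Definition _ := [Choice of reed_muller F d n by <:].

Definition rm_mnm : pred 'X_{1..n < d.+1} :=
  fun m => [forall j, bmnm m j <= #|F|.-1]%N.

Lemma is_reed_mullerP (f : {mpoly F[n]}) :
  reflect (forall m, m \in msupp f ->
             (mdeg m < d.+1)%N /\ forall j, (m j <= #|F|.-1)%N)
          (is_reed_muller F d n f).
Proof.
apply: (iffP andP) => [[szf /forallP degf] m mf|H].
  split; first exact: leq_trans (msize_mdeg_lt mf) szf.
  by move=> j; apply: leq_trans (degf j); apply: (leq_bigmax_seq m).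
split.
  rewrite msizeE; apply/bigmax_leqP_seq => m mf _.
  by have [] := H _ mf.
by apply/forallP => j; apply/bigmax_leqP_seq => m mf _; have [_] := H _ mf.
Qed.

Lemma is_reed_muller_closed : subsemimod_closed (is_reed_muller F d n).
Proof.
split; first split.
- by apply/is_reed_mullerP => m; rewrite msupp0.
- move=> f g /is_reed_mullerP rf /is_reed_mullerP rg.
  apply/is_reed_mullerP => m /msuppD_le; rewrite mem_cat.
  by case/orP => [/rf|/rg].
- move=> c f /is_reed_mullerP rf; apply/is_reed_mullerP => m /msuppZ_le.
  exact: rf.
Qed.

HB.instance Definition _ :=
  GRing.isSubmodClosed.Build F {mpoly F[n]} (is_reed_muller F d n)
    is_reed_muller_closed.
HB.instance Definition _ := [SubChoice_isSubLmodule of reed_muller F d n by <:].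

Definition rm_coord (f : reed_muller F d n) : 'rV[F]_#|rm_mnm| :=
  \row_i (val f)@_(bmnm (enum_val i)).

Definition rm_poly (v : 'rV[F]_#|rm_mnm|) : {mpoly F[n]} :=
  \sum_i v 0 i *: 'X_[bmnm (enum_val i)].

Lemma rm_poly_subproof v : is_reed_muller F d n (rm_poly v).
Proof.
rewrite -[is_reed_muller _ _ _ _]/(rm_poly v \in is_reed_muller F d n).
apply: rpred_sum => i _; apply: rpredZ; apply/is_reed_mullerP => m.
rewrite msuppX inE => /eqP ->; split; first exact: bmdeg.
by apply/forallP; apply: (enum_valP i).
Qed.

Definition rm_of_coord v := ReedMuller (rm_poly_subproof v).

Lemma rm_coord_linear : linear rm_coord.
Proof.
by move=> c f g; apply/rowP => i; rewrite !mxE /= mcoeffD mcoeffZ.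
Qed.

Lemma rm_coordK : cancel rm_coord rm_of_coord.
Proof.
move=> f; apply/val_inj/mpolyP => m /=; rewrite /rm_poly raddf_sum /=.
have [mf|mf] := boolP (m \in msupp (val f)).
  have /is_reed_mullerP/(_ m mf)[dm Xm] := valP f.
  have bm : BMultinom dm \in rm_mnm by apply/forallP.
  rewrite (bigD1 (enum_rank_in bm (BMultinom dm))) //= big1 => [|i ne_i].
    by rewrite addr0 mcoeffZ mcoeffX mxE enum_rankK_in //= eqxx mulr1.
  rewrite mcoeffZ mcoeffX; case: eqP => [e|_]; last by rewrite mulr0.
  case/eqP: ne_i; apply: enum_val_inj; rewrite enum_rankK_in //.
  exact/val_inj.
rewrite (memN_msupp_eq0 mf) big1 // => i _; rewrite mcoeffZ mcoeffX mxE.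
case: eqP => [->|_]; last by rewrite mulr0.
by rewrite (memN_msupp_eq0 mf) mul0r.
Qed.

Lemma rm_of_coordK : cancel rm_of_coord rm_coord.
Proof.
move=> v; apply/rowP => i; rewrite mxE /= /rm_poly raddf_sum /= (bigD1 i) //=.
rewrite mcoeffZ mcoeffX eqxx mulr1 big1 ?addr0 // => j ne_ji.
rewrite mcoeffZ mcoeffX; case: eqP => [e|_]; last by rewrite mulr0.
by case/eqP: ne_ji; apply/enum_val_inj/val_inj.
Qed.

Lemma rm_vector_subproof : Vector.axiom #|rm_mnm| (reed_muller F d n).
Proof.
by exists rm_coord; [exact: rm_coord_linear | exists rm_of_coord;
  [exact: rm_coordK | exact: rm_of_coordK]].
Qed.

HB.instance Definition _ :=
  Lmodule_hasFinDim.Build F (reed_muller F d n) rm_vector_subproof.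
HB.instance Definition _ : isCountable (reed_muller F d n) :=
  CanIsCountable rm_coordK.
HB.instance Definition _ : isFinite (reed_muller F d n) :=
  CanIsFinite rm_coordK.

End ReedMullerVector.

Definition zero_set (F : finFieldType) (n : nat) (f : {mpoly F[n]}) :
    {set {ffun 'I_n -> F}} :=
  [set x : {ffun 'I_n -> F} | f.@[x] == 0].

Definition weight (F : finFieldType) (n : nat) (f : {mpoly F[n]}) : nat :=
  (#|F| ^ n - #|zero_set f|)%N.

(* The condition \nu_p(|f|) >= t, with \nu_p(0) = oo, is p ^ t %| |f|; the
   characteristic p of F is recovered as the prime divisor of q = #|F|. *)
Definition N_rm (F : finFieldType) (d n t : nat) : nat :=
  #|[set f : reed_muller F d n | (pdiv #|F| ^ t %| weight f)%N]|.
Arguments N_rm : clear implicits.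

Definition dim_rm (F : finFieldType) (d n : nat) : nat :=
  \dim {: reed_muller F d n}.
Arguments dim_rm : clear implicits.

(* Main.v *)
Require Import Defs.
From mathcomp Require Import all_boot all_order all_algebra.
From mathcomp Require Import finfield.
From mathcomp Require Import mpoly.

(** Write q = #|F| and p for the characteristic of F, and let c(k) denote the
monomial (X_1 ... X_n)^k.

The weight of f, read in F, is the sum over all points of f^(q-1), because
a^(q-1) is 1 for a <> 0 and 0 for a = 0.  Summing a monomial over F^n gives 0
as soon as one exponent is smaller than q-1; since f^(q-1) has degree at most
n(q-1), only its monomial c(q-1) survives ([dvdn_weight]).  So p divides the
weight iff the coefficient of c(q-1) in f^(q-1) vanishes.

This coefficient behaves like the Hasse invariant of a hypersurface of degree n
in n variables.  With q = p^(k+1), write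
f^(q-1) = f^(p-1) * (f^(p^k-1))^p.  Modulo p, the exponents of c(q-1) are all
-1, so the monomial taken from f^(p-1) has all exponents at least p-1, and by
degree it is c(p-1).  Hence the coefficient is the one of f^(p-1) at c(p-1)
times a p-th power of the same quantity for p^k, and by induction it vanishes
iff the coefficient of c(p-1) in f^(p-1) does ([mcoeff_exp_ppower]).

For p = 3 that last coefficient is a quadratic form in the coefficients of f:
the sum of f_m f_(c(2)-m) over the monomials m of degree n that divide c(2)
([mcoeff_sqr]).  The involution m -> c(2)-m has the single fixed point c(1), so
the form is a square plus hyperbolic planes; splitting the planes off one at a
time shows that its zeros make up exactly 1/q of the whole space
([card_quadric]).  This is the first claim.

The dimension is the number of monomials of degree at most n with all exponents
below q; inclusion-exclusion on the set of variables whose exponent is at least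
q turns it into the alternating sum ([card_bounded_mnm]). *)

Set Implicit Arguments.
Unset Strict Implicit.
Unset Printing Implicit Defensive.

Import GRing.Theory.

(** * Counting monomials *)

Section MonomialCount.
Variable n : nat.

Lemma leq_mnm_mdeg (m : 'X_{1..n}) j : m j <= mdeg m.
Proof. by rewrite mdegE (bigD1 j) //= leq_addr. Qed.

Lemma card_bmultinom d : #|{: 'X_{1..n < d.+1}}| = 'C(n + d, n).
Proof.
rewrite -card_partial_ord_partitions.
pose f (m : 'X_{1..n < d.+1}) := [tuple inord (m i) : 'I_d.+1 | i < n].
have fE (m : 'X_{1..n < d.+1}) i : tnth (f m) i = m i :> nat.
  by rewrite tnth_mktuple inordK // (leq_ltn_trans (leq_mnm_mdeg m i)) ?bmdeg.
have finj : injective f.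
  by move=> m m' e; apply/val_inj/mnmP => i; rewrite -!fE e.
rewrite -cardsT -(card_imset _ finj); apply: eq_card => t; rewrite inE big_tuple.
apply/imsetP/idP => [[m _ ->]|st].
  by rewrite (eq_bigr m) -?mdegE -1?ltnS ?bmdeg // => i _; rewrite fE.
have dt : mdeg [multinom (tnth t i : nat) | i < n] < d.+1.
  by rewrite ltnS mdegE (eq_bigr (fun i => tnth t i : nat)) // => i _; rewrite mnmE.
exists (BMultinom dt) => //; apply: eq_from_tnth => i; apply: val_inj.
by rewrite /= fE mnmE.
Qed.

(** Subtracting u maps these monomials onto all those of degree at most
    d - mdeg u. *)
Lemma card_mnm_ge d (u : 'X_{1..n}) :
  #|[set m : 'X_{1..n < d.+1} | (u <= m)%MM]| =
  if mdeg u <= d then 'C(n + (d - mdeg u), n) else 0.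
Proof.
case: ifP => du; last first.
  apply/eqP; rewrite cards_eq0 -subset0; apply/subsetP => m; rewrite !inE => um.
  have := bmdeg m; rewrite -(submK um) mdegD => /(leq_ltn_trans (leq_addl _ _)).
  by rewrite ltnS du.
rewrite -card_bmultinom -cardsT.
have dm (m : 'X_{1..n < (d - mdeg u).+1}) : mdeg (m + u)%MM < d.+1.
  by rewrite mdegD ltnS addnC -leq_subRL // -ltnS bmdeg.
rewrite -(card_imset (f := fun m => BMultinom (dm m))); last first.
  by move=> m m' /(congr1 val) /addIm /val_inj.
apply: eq_card => m; rewrite inE; apply/idP/imsetP => [um|[m' _ ->]]; last first.
  exact: lem_addl.
have dm' : mdeg (m - u)%MM < (d - mdeg u).+1.
  by rewrite ltnS leq_subRL // addnC -mdegD submK // -ltnS bmdeg.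
by exists (BMultinom dm') => //; apply: val_inj; rewrite /= submK.
Qed.

Local Open Scope ring_scope.

Lemma sum_set_card (R : nzRingType) (h : nat -> R) :
  \sum_(J : {set 'I_n}) h #|J| = \sum_(k < n.+1) h k *+ 'C(n, k).
Proof.
have cJ (J : {set 'I_n}) : (#|J| < n.+1)%N.
  by rewrite ltnS -[leqRHS]card_ord max_card.
rewrite (partition_big (fun J : {set 'I_n} => Ordinal (cJ J)) xpredT) //=.
apply: eq_bigr => k _; rewrite (eq_bigr (fun=> h k)) => [|J /eqP<- //].
by rewrite sumr_const; have := card_draws 'I_n k; rewrite card_ord cardsE => ->.
Qed.

(** Inclusion-exclusion: the condition on m has the indicator
    prod_j (1 - [q <= m j]); in the expanded product, the term of a set J of
    variables counts the multiples of u J = prod_(j in J) X_j^q.  The sum may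
    stop at d %/ q because d - q j must be nonnegative, and this also keeps the
    truncated subtraction harmless. *)
Lemma card_bounded_mnm q d : (0 < q)%N ->
  #|[set m : 'X_{1..n < d.+1} | [forall j, m j < q]%N]|%:Z =
  \sum_(0 <= j < (d %/ q).+1)
     (-1) ^+ j * ('C(n, j))%:Z * ('C(n + d - q * j, n))%:Z.
Proof.
move=> q_gt0.
pose u (J : {set 'I_n}) := [multinom (j \in J) * q | j < n]%N.
have uE J (m : 'X_{1..n}) :
    (u J <= m)%MM = [forall (j | j \in J), q <= m j]%N.
  apply/mnm_lepP/forall_inP => [le j jJ|le j].
    by have := le j; rewrite mnmE jJ mul1n.
  by rewrite mnmE; case: (boolP (j \in J)) => // /le; rewrite mul1n.
have du J : mdeg (u J) = (q * #|J|)%N.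
  rewrite mdegE mulnC -sum1_card big_distrl /= [RHS]big_mkcond /=.
  by apply: eq_bigr => j _; rewrite mnmE; case: (j \in J); rewrite ?mul1n ?mul0n.
have indicator (m : 'X_{1..n}) : ([forall j, m j < q]%N : nat)%:Z =
    \sum_(J : {set 'I_n}) (-1) ^+ #|J| * ((u J <= m)%MM : nat)%:Z.
  transitivity (\prod_(j < n) (- ((q <= m j)%N : nat)%:Z + 1)).
    case: forallP => [lt|/forallP]; first by rewrite big1 // => j _; rewrite leqNgt lt.
    rewrite negb_forall => /existsP[j]; rewrite -leqNgt => ge.
    by rewrite (bigD1 j) //= ge mul0r.
  rewrite bigA_distr; apply: eq_bigr => J _; rewrite uE.
  rewrite (bigID (mem J)) /= [X in _ * X]big1 ?mulr1 => [|j /negPf-> //].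
  rewrite (eq_bigr (fun j => -1 * ((q <= m j)%N : nat)%:Z)) => [|j ->]; last first.
    by rewrite mulN1r.
  rewrite big_split prodr_const /=; congr (_ * _).
  case: forall_inP => [le|/forall_inP]; first by rewrite big1 // => j /le->.
  rewrite negb_forall_in => /exists_inP[j jJ /negPf nle].
  by rewrite (bigD1 j) //= nle mul0r.
pose g k := if (q * k <= d)%N then 'C(n + (d - q * k), n) else 0%N.
have -> : #|[set m : 'X_{1..n < d.+1} | [forall j, m j < q]%N]|%:Z =
    \sum_(k < n.+1) ((-1) ^+ k * (g k)%:Z) *+ 'C(n, k).
  rewrite -(sum_set_card (fun k => (-1) ^+ k * (g k)%:Z)).
  transitivity (\sum_(m : 'X_{1..n < d.+1}) ([forall j, m j < q]%N : nat)%:Z).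
    rewrite -(big_morph Posz PoszD (erefl _)) -sum1_card big_mkcond /=.
    by congr Posz; apply: eq_bigr => m _; rewrite inE; case: ifP.
  under eq_bigr do rewrite indicator.
  rewrite exchange_big; apply: eq_bigr => J _; rewrite -mulr_sumr; congr (_ * _).
  rewrite /g -du -card_mnm_ge -sum1_card.
  rewrite (big_morph Posz PoszD (erefl _)) [RHS]big_mkcond; apply: eq_bigr => m _.
  by rewrite inE; case: ifP.
(* Both ranges of j are extended to a common one: the terms with j > n vanish
   through the first binomial, those with q j > d through g. *)
pose F j : int := (-1) ^+ j * ('C(n, j))%:Z * (g j)%:Z.
transitivity (\sum_(0 <= j < (n + d %/ q).+1) F j).
  rewrite [RHS](big_cat_nat (n := n.+1)) ?ltnS ?leq_addr //=.
  rewrite [X in _ + X]big_nat [X in _ + X]big1.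
    by rewrite addr0 big_mkord; apply: eq_bigr => k _; rewrite -mulr_natr /F mulrAC natz.
  by move=> j /andP[lt _]; rewrite /F bin_small // mulr0 mul0r.
rewrite (big_cat_nat (n := (d %/ q).+1)) ?ltnS ?leq_addl //=.
rewrite [X in _ + X]big_nat [X in _ + X]big1.
  rewrite addr0 !big_nat; apply: eq_bigr => j /andP[_].
  rewrite ltnS leq_divRL // mulnC => le.
  by rewrite /F /g le addnBA.
move=> j /andP[lt _]; rewrite /F /g leqNgt [(q * j)%N]mulnC -ltn_divLR //.
by rewrite lt mulr0.
Qed.

End MonomialCount.

(** * Zeros of a quadratic form with one-dimensional anisotropic part *)

Section Quadric.
Local Open Scope ring_scope.
Variables (F : finFieldType) (V : finLmodType F).

(** Moving v by c *: w v changes L by c, so D splits into lines on which L takes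
    every value exactly once; the direction w v may depend on v, provided that
    it is constant along the line. *)
Lemma card_by_level (D : {set V}) (L : V -> F) (w : V -> V) :
    (forall v c, v \in D -> v + c *: w v \in D) ->
    (forall v c, v \in D -> L (v + c *: w v) = L v + c) ->
    (forall v c, w (v + c *: w v) = w v) ->
  #|D| = (#|F| * #|[set v in D | L v == 0%R]|)%N.
Proof.
move=> DD LD wD; set Z := [set v in D | _].
pose h (u : F * V) := u.2 + u.1 *: w u.2.
have -> : D = h @: setX [set: F] Z.
  apply/setP => v; apply/idP/imsetP => [Dv | [[c u]]].
    exists (L v, v + (- L v) *: w v).
      by rewrite !inE /= DD // LD // subrr eqxx.
    by rewrite /h /= wD -addrA -scalerDl addNr scale0r addr0.
  by rewrite !inE /= => /andP[Du _] ->; apply: DD.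
rewrite card_in_imset ?cardsX ?cardsT //.
move=> [c u] [d v]; rewrite !inE /= => /andP[Du /eqP Lu] /andP[Dv /eqP Lv].
rewrite /h /= => e; have ecd : c = d.
  by have := LD _ c Du; rewrite e LD // Lu Lv !add0r => ->.
have ew : w u = w v by rewrite -(wD u c) e wD.
by move: e; rewrite ecd ew => /addIr ->.
Qed.

Variables (I : finType) (x : I -> V -> F) (e : I -> V) (s : I -> I) (t0 : I).
Hypothesis two_neq0 : 2%:R != 0 :> F.

(** The form is x_t0^2 plus products 2 x_t x_(s t).  Remove one pair (t, s t) and
    compare: where x_t <> 0 the form is affine and nonconstant in x_(s t), so
    one vector in q is a zero; where x_t = 0 the zeros are those of the smaller
    form, whose zero set is split evenly by the values of x_t.  The vectors e
    only need to be dual to the coordinates x on S, so the lemma applies to a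
    form that ignores part of the coordinates of V. *)
Lemma card_quadric (S : {set I}) :
    (forall i j v c, i \in S -> j \in S ->
       x i (v + c *: e j) = x i v + c * (i == j)%:R) ->
    (forall i, i \in S -> s i \in S) ->
    (forall i, i \in S -> s (s i) = i) ->
    t0 \in S -> (forall i, i \in S -> (s i == i) = (i == t0)) ->
  #|V| = (#|F| * #|[set v : V | (\sum_(i in S) x i v * x (s i) v == 0)%R]|)%N.
Proof.
have [k] := ubnP #|S|; elim: k S => // k IH S leSk xe sS ss St0 sfix.
have cardx t : t \in S -> #|V| = (#|F| * #|[set v | x t v == 0%R]|)%N.
  move=> St; have := @card_by_level [set: V] (x t) (fun=> e t).
  rewrite cardsT => -> //=; first 1 last.
  - by move=> v c _; rewrite xe // eqxx mulr1.
  - by congr (_ * _)%N; apply: eq_card => v; rewrite !inE.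
have [S1|] := eqVneq S [set t0].
  rewrite (cardx t0 St0); congr (_ * _)%N; apply: eq_card => v.
  have/eqP st0 : s t0 == t0 by rewrite sfix ?eqxx.
  by rewrite !inE S1 big_set1 st0 mulf_eq0 orbb.
rewrite eqEsubset sub1set St0 andbT => /subsetPn[t St]; rewrite inE => nt.
pose S' := S :\ t :\ s t.
have nst : s t != t by rewrite sfix.
have sti : {in S &, injective s} by move=> i j Si Sj /(congr1 s); rewrite !ss.
have S'S i : i \in S' -> i \in S by rewrite !inE => /and3P[].
have QS v : \sum_(i in S) x i v * x (s i) v =
    2%:R * x t v * x (s t) v + \sum_(i in S') x i v * x (s i) v.
  rewrite (big_setD1 t) //= (big_setD1 (s t)) ?inE ?nst ?sS //= addrA ss //.
  by rewrite [x (s t) v * _]mulrC -mulrA mulr_natl mulr2n.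
have xt i j v c : i \in S' -> j \in S -> (j == t) || (j == s t) ->
    x i (v + c *: e j) = x i v.
  rewrite !inE => /and3P[n1 n2 Si] Sj jt; rewrite xe //.
  suff /negPf-> : i != j by rewrite mulr0 addr0.
  by case/orP: jt => /eqP->.
have sS' i : i \in S' -> s i \in S'.
  rewrite !inE => /and3P[n1 n2 Si]; rewrite sS // andbT; apply/andP; split.
    by apply: contraNN n2 => /eqP/sti-> //.
  by apply: contraNN n1 => /eqP<-; rewrite ss.
pose Q' v := \sum_(i in S') x i v * x (s i) v.
have Q't j v c : j \in S -> (j == t) || (j == s t) ->
    Q' (v + c *: e j) = Q' v.
  by move=> Sj jt; apply: eq_bigr => i S'i; rewrite !(xt _ j) ?sS'.
have IH' : #|V| = (#|F| * #|[set v | Q' v == 0%R]|)%N.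
  apply: IH => //.
  - have: S' \proper S by apply/properP; split;
      [apply/subsetP | exists t; rewrite // !inE eqxx andbF].
    by move/proper_card => lt; rewrite (leq_trans lt).
  - by move=> i j v c /S'S Si /S'S Sj; apply: xe.
  - by move=> i /S'S; apply: ss.
  - rewrite !inE St0 andbT [t0 == t]eq_sym nt andbT; apply: contraNneq nt => et0.
    by have:= sfix t0 St0; rewrite {1}et0 ss // eqxx.
  - by move=> i /S'S; apply: sfix.
set Z := [set v | _].
have Zt : #|[set v | Q' v == 0%R]| = (#|F| * #|Z :&: [set v | x t v == 0%R]|)%N.
  rewrite (@card_by_level _ (x t) (fun=> e t)) //.
  - congr (_ * _)%N; apply: eq_card => v; rewrite !inE QS.
    by case: (x t v =P 0) => [->|]; rewrite ?andbF // mulr0 mul0r add0r.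
  - by move=> v c; rewrite !inE Q't ?eqxx.
  - by move=> v c _; rewrite xe // eqxx mulr1.
have Znt : #|[set v | x t v != 0%R]| = (#|F| * #|Z :\: [set v | x t v == 0%R]|)%N.
  have xtst v c : x t (v + c *: e (s t)) = x t v.
    by rewrite xe ?sS // eq_sym (negPf nst) mulr0 addr0.
  rewrite (@card_by_level _ (fun v => \sum_(i in S) x i v * x (s i) v)
             (fun v => (2%:R * x t v)^-1 *: e (s t))).
  - by congr (_ * _)%N; apply: eq_card => v; rewrite !inE.
  - by move=> v c; rewrite !inE scalerA xtst.
  - move=> v c; rewrite inE => nx; rewrite !QS scalerA xtst.
    rewrite -/(Q' _) Q't ?sS ?eqxx ?orbT // xe ?sS // eqxx mulr1 mulrDr.
    by rewrite [c * _]mulrC mulVKf ?mulf_neq0 // addrAC.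
  - by move=> v c; rewrite scalerA xtst.
have q_gt0 : (0 < #|F|)%N by apply/card_gt0P; exists 0.
have eV : #|V| = (#|[set v | x t v == 0%R]| + #|[set v | x t v != 0%R]|)%N.
  rewrite -(cardsC [set v | x t v == 0%R]); congr (_ + _)%N.
  by apply: eq_card => v; rewrite !inE.
have eZ := cardsID [set v | x t v == 0%R] Z.
have e1 := cardx t St.
have /eqP := IH'; rewrite e1 eqn_pmul2l // Zt => /eqP e2.
by rewrite -e1 eV e2 Znt -mulnDr eZ.
Qed.

End Quadric.

(** * Weights modulo the characteristic *)

(** The exponent of (X_1 ... X_n)^c. *)
Definition cmnm (n c : nat) : 'X_{1..n} := [multinom c | i < n].

Lemma mdeg_cmnm n c : mdeg (cmnm n c) = (n * c)%N.
Proof.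
rewrite mdegE (eq_bigr (fun=> c)) => [|i _]; last by rewrite mnmE.
by rewrite sum_nat_const card_ord.
Qed.

Lemma eq_cmnm_deg n c (m : 'X_{1..n}) :
  (mdeg m <= n * c)%N -> (forall j, c <= m j)%N -> m = cmnm n c.
Proof.
move=> dm cm; have le : (cmnm n c <= m)%MM by apply/mnm_lepP => j; rewrite mnmE.
have := submK le; have : mdeg (m - cmnm n c) == 0%N.
  by rewrite -leqn0 -(leq_add2r (mdeg (cmnm n c))) -mdegD submK // mdeg_cmnm.
by rewrite mdeg_eq0 => /eqP ->; rewrite add0m.
Qed.

Lemma msize_exp (R : idomainType) n (f : {mpoly R[n]}) d k :
  (msize f <= d.+1 -> msize (f ^+ k)%R <= (d * k).+1)%N.
Proof.
move=> df; elim: k => [|k IH]; first by rewrite expr0 msize1.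
have [->|f0] := eqVneq f 0%R; first by rewrite expr0n msize0.
rewrite exprS msizeM ?expf_neq0 // mulnS.
have f0' := expf_neq0 k f0.
rewrite -msize_poly_eq0 -lt0n in f0; rewrite -msize_poly_eq0 -lt0n in f0'.
move: (leq_add df IH); case: (msize f) f0 => // a _; rewrite addSn /=.
by rewrite addnS addSn ltnS.
Qed.

Section Weight.
Local Open Scope ring_scope.
Variable F : finFieldType.

(** Some b <> 0 has b^k <> 1, as 'X^k - 1 has at most k roots; the substitution
    a -> b a multiplies the sum by b^k.  For k = 0 the sum is q, which is 0
    because a -> a + 1 adds it to the sum of all the elements of F. *)
Lemma sum_expr_eq0 k : (k < #|F|.-1)%N -> \sum_(a : F) a ^+ k = 0.
Proof.
move=> ltk.
have [b nb bk] : exists2 b : F, b != 0 & (b ^+ k != 1) || (k == 0)%N.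
  have [->|k_neq0] := eqVneq k 0%N.
    by exists 1; rewrite ?oner_eq0 ?orbT.
  case: (boolP [forall b : F, (b != 0) ==> (b ^+ k == 1)]); last first.
    rewrite negb_forall => /existsP[b]; rewrite negb_imply => /andP[nb bk].
    by exists b; rewrite ?bk.
  move=> /forallP all1.
  have nz : 'X^k - 1 != 0 :> {poly F}.
    by rewrite -size_poly_eq0 size_XnsubC // lt0n.
  have := max_poly_roots nz (rs := enum [set~ (0 : F)]).
  rewrite enum_uniq size_XnsubC ?lt0n // -cardE cardsC1 => H.
  suff: (#|F|.-1 < k.+1)%N by rewrite ltnS leqNgt ltk.
  apply: H => //; apply/allP => a; rewrite mem_enum !inE => na.
  rewrite rootE !hornerE subr_eq0.
  exact: (implyP (all1 a) na).
have [k0|k_neq0] := eqVneq k 0%N.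
  rewrite k0; have : \sum_(a : F) a = \sum_(a : F) a + \sum_(a : F) a ^+ 0.
    by rewrite {1}(reindex_inj (addIr 1)) big_split.
  by move/eqP; rewrite -subr_eq0 opprD addrA subrr add0r oppr_eq0 => /eqP.
move: bk; rewrite (negPf k_neq0) orbF => bk.
have e : \sum_(a : F) a ^+ k = b ^+ k * \sum_(a : F) a ^+ k.
  rewrite mulr_sumr (reindex_inj (mulfI nb)) /=.
  by apply: eq_bigr => a _; rewrite exprMn.
have /eqP : (b ^+ k - 1) * \sum_(a : F) a ^+ k = 0.
  by rewrite mulrBl mul1r -e subrr.
by rewrite mulf_eq0 subr_eq0 (negPf bk) => /eqP.
Qed.

Lemma sum_expr_pred_card : \sum_(a : F) a ^+ #|F|.-1 = -1.
Proof.
have q1 := finNzRing_gt1 F; have q1' : (0 < #|F|.-1)%N by rewrite -subn1 subn_gt0.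
rewrite (bigD1 0) //= expr0n (gtn_eqF q1') add0r.
have /eqP := sum_expr_eq0 q1'; rewrite (bigD1 0) //= expr0 addrC addr_eq0 => /eqP <-.
apply: eq_bigr => a na.
apply: (mulfI na); rewrite -exprS prednK ?expf_card ?expr0 ?mulr1 //.
exact: ltnW.
Qed.

(** A monomial whose exponents are all at least q - 1 can only be the extreme
    one, by the bound on the degree; every other monomial sums to 0. *)
Lemma sum_meval_eq0 n (g : {mpoly F[n]}) :
    (msize g <= (n * #|F|.-1).+1)%N ->
  (\sum_(v : {ffun 'I_n -> F}) g.@[v] == 0) = (g@_(cmnm n #|F|.-1) == 0).
Proof.
move=> dg; set c := cmnm n _.
have Xsum m : \sum_(v : {ffun 'I_n -> F}) \prod_i v i ^+ m i =
              \prod_(i < n) \sum_(a : F) a ^+ m i by rewrite bigA_distr_bigA.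
have -> : \sum_(v : {ffun 'I_n -> F}) g.@[v] =
    \sum_(m <- msupp g) g@_m * \prod_(i < n) \sum_(a : F) a ^+ m i.
  under eq_bigr do rewrite mevalE.
  rewrite exchange_big /=.
  by apply: eq_bigr => m _; rewrite -mulr_sumr Xsum.
have E m : m \in msupp g -> m != c ->
    g@_m * \prod_(i < n) \sum_(a : F) a ^+ m i = 0.
  move=> mg; apply: contraNeq; rewrite mulf_eq0 negb_or => /andP[_ /prodf_neq0 nz].
  rewrite /c -(@eq_cmnm_deg n #|F|.-1 m) //.
    by rewrite -ltnS; apply: leq_trans dg; apply: msize_mdeg_lt.
  move=> j; rewrite leqNgt; apply/negP => lt.
  by have := nz j isT; rewrite sum_expr_eq0 ?eqxx.
have [cg|cg] := boolP (c \in msupp g); last first.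
  rewrite big_seq big1 ?eqxx ?(memN_msupp_eq0 cg) ?eqxx // => m mg.
  by apply: E => //; apply: contraNneq cg => <-.
rewrite (bigD1_seq c) //= [X in _ + X]big_seq_cond.
rewrite [X in _ + X]big1 => [|m /andP[]]; last exact: E.
rewrite addr0 (eq_bigr (fun=> -1)) => [|i _]; last first.
  by rewrite mnmE sum_expr_pred_card.
by rewrite prodr_const mulf_eq0 signr_eq0 orbF.
Qed.

Lemma weight_sum n (f : {mpoly F[n]}) :
  (weight f)%:R = \sum_(v : {ffun 'I_n -> F}) (f ^+ #|F|.-1).@[v] :> F.
Proof.
have q1 := finNzRing_gt1 F; have q1' : (0 < #|F|.-1)%N by rewrite -subn1 subn_gt0.
have -> : weight f = #|~: zero_set f|.
  by rewrite cardsCs setCK card_ffun card_ord.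
rewrite (bigID (mem (zero_set f))) /= big1 => [|v]; last first.
  by rewrite inE => /eqP fv; rewrite rmorphXn /= fv expr0n gtn_eqF.
rewrite add0r -sum1_card natr_sum; apply: eq_big => [v | v]; rewrite !inE //.
move=> nz; apply: (mulfI nz); rewrite rmorphXn /= -exprS prednK ?expf_card ?mulr1 //.
exact: ltnW.
Qed.

Lemma dvdn_weight n p (f : {mpoly F[n]}) : p \in [pchar F] ->
    (msize f <= n.+1)%N ->
  (p %| weight f)%N = ((f ^+ #|F|.-1)@_(cmnm n #|F|.-1) == 0).
Proof.
move=> pF df; rewrite (dvdn_pcharf pF) weight_sum sum_meval_eq0 //.
exact: msize_exp.
Qed.

End Weight.

(** * Reduction to the prime field exponent *)

Section Hasse.
Local Open Scope ring_scope.
Variables (F : fieldType) (p n : nat).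
Hypothesis pF : p \in [pchar F].

Lemma mcoeff_frobenius (g : {mpoly F[n]}) m :
  (g ^+ p)@_m != 0 -> exists2 u, m = (u *+ p)%MM & u \in msupp g.
Proof.
have pP : p \in [pchar {mpoly F[n]}] by rewrite pchar_lalg.
rewrite -(pFrobenius_autE pP) {1}[g]mpolyE rmorph_sum raddf_sum /= => nz.
have /hasP[u ug] : has (fun u => (pFrobenius_aut pP (g@_u *: 'X_[u]))@_m != 0) (msupp g).
  apply: contraNT nz => /hasPn h; rewrite big_seq big1 // => u /h.
  by rewrite negbK => /eqP.
rewrite pFrobenius_autE exprZn mcoeffZ mcoeffXn mulf_eq0 negb_or => /andP[_].
by have [<- _|_] := eqVneq (u *+ p)%MM m; [exists u | rewrite eqxx].
Qed.

Lemma mcoeff_frobeniusM (g : {mpoly F[n]}) u :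
  (g ^+ p)@_(u *+ p)%MM = g@_u ^+ p.
Proof.
have pP : p \in [pchar {mpoly F[n]}] by rewrite pchar_lalg.
have p_gt0 := prime_gt0 (pcharf_prime pF).
have E v : (pFrobenius_aut pP (g@_v *: 'X_[v]))@_(u *+ p)%MM =
    g@_v ^+ p * (v == u)%:R.
  rewrite pFrobenius_autE exprZn mcoeffZ mcoeffXn; congr (_ * (_ : bool)%:R).
  apply/eqP/eqP => [/mnmP e|-> //]; apply/mnmP => i.
  by have /eqP := e i; rewrite !mulmnE eqn_pmul2r // => /eqP.
rewrite -(pFrobenius_autE pP) {1}[g]mpolyE rmorph_sum raddf_sum /=.
rewrite (eq_bigr _ (fun v _ => E v)).
have [ug|ug] := boolP (u \in msupp g).
  rewrite (bigD1_seq u) //= eqxx mulr1 big1 ?addr0 // => v /negPf->.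
  by rewrite mulr0.
rewrite (memN_msupp_eq0 ug) expr0n gtn_eqF // big_seq big1 // => v vg.
by case: eqP ug => [<-|_]; rewrite ?vg ?mulr0.
Qed.

Lemma mcoeffM_unique (g h : {mpoly F[n]}) u v :
    (forall u' v', g@_u' != 0 -> h@_v' != 0 ->
       (u' + v')%MM = (u + v)%MM -> u' = u) ->
  (g * h)@_(u + v) = g@_u * h@_v.
Proof.
move=> uniq; set k := (mdeg (u + v)).+1.
have bu : (mdeg u < k)%N by rewrite ltnS mdegD leq_addr.
have bv : (mdeg v < k)%N by rewrite ltnS mdegD leq_addl.
rewrite mcoeffM (bigD1 (BMultinom bu, BMultinom bv)) ?eqxx //=.
rewrite big1 ?addr0 // => -[u' v'] /= /andP[/eqP e ne].
apply: contraNeq ne; rewrite mulf_eq0 negb_or => /andP[gu hv].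
have eu := uniq _ _ gu hv (esym e); move: e; rewrite eu => /addmI ev.
by rewrite xpair_eqE !bmeqP /= eu -ev !eqxx.
Qed.

(** The factorization f^(pN-1) = f^(p-1) * (f^(N-1))^p for N a power of p: the
    second factor only has exponents divisible by p, so a monomial of the first
    one that contributes has all its exponents congruent to -1 modulo p, hence
    at least p - 1, and the degree leaves c(p-1) only.  The second factor
    contributes a p-th power of the coefficient for N. *)
Lemma mcoeff_exp_ppower (f : {mpoly F[n]}) k : (msize f <= n.+1)%N ->
  ((f ^+ (p ^ k.+1).-1)@_(cmnm n (p ^ k.+1).-1) == 0) =
  ((f ^+ p.-1)@_(cmnm n p.-1) == 0).
Proof.
move=> df; have p_gt0 := prime_gt0 (pcharf_prime pF).
elim: k => [|k IH]; first by rewrite expn1.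
set N := (p ^ k.+1)%N in IH *.
have N_gt0 : (0 < N)%N by rewrite expn_gt0 p_gt0.
have e : (p ^ k.+2).-1 = (p.-1 + N.-1 * p)%N.
  by rewrite expnSr -/N -{1}(prednK N_gt0) mulSn -{1}(prednK p_gt0).
have ec : cmnm n (p ^ k.+2).-1 = (cmnm n p.-1 + (cmnm n N.-1 *+ p))%MM.
  by apply/mnmP => i; rewrite mnmDE mulmnE !mnmE.
rewrite ec e exprD exprM mcoeffM_unique; last first.
  move=> u v gu /mcoeff_frobenius[w -> _] euv; apply: eq_cmnm_deg.
    rewrite -ltnS; apply: leq_trans (msize_exp p.-1 df); apply: msize_mdeg_lt.
    by rewrite mcoeff_msupp.
  move=> j; have /mnmP/(_ j) := euv; rewrite !mnmDE !mulmnE !mnmE => ej.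
  have : (u j).+1 = 0 %[mod p].
    rewrite -(modnMDl (w j)) addnS addnC ej -addSn prednK //.
    by rewrite -mulSn modnMl mod0n.
  by move/eqP; rewrite mod0n => /dvdn_leq -/(_ isT); rewrite -{1}(prednK p_gt0).
by rewrite mcoeff_frobeniusM mulf_eq0 expf_eq0 IH p_gt0 andTb orbb.
Qed.

End Hasse.

(** * The quadratic form for characteristic 3 *)

Section Square.
Local Open Scope ring_scope.
Variables (F : finFieldType) (n : nat).

Local Notation I := 'X_{1..n < (n * 2).+1}.

(** The monomials that can occur in a product f_m f_(c(2)-m) when deg f <= n;
    bounding the degree by 2 n makes the complement available on the whole
    index type. *)
Definition mid_mnm : {set I} :=
  [set m : I | (m <= cmnm n 2)%MM & mdeg m == n].

Definition compl_mnm (m : I) : I := insubd m (cmnm n 2 - m)%MM.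

Lemma val_compl_mnm m : compl_mnm m = (cmnm n 2 - m)%MM :> 'X_{1..n}.
Proof. by rewrite val_insubd ltnS -[X in (_ <= X)%N]mdeg_cmnm mdegB. Qed.

Lemma compl_mnmK : {in mid_mnm, involutive compl_mnm}.
Proof.
move=> m; rewrite inE => /andP[le2 _]; apply: val_inj.
by rewrite /= !val_compl_mnm submBA // addmC addmK.
Qed.

Lemma compl_mnm_mid m : m \in mid_mnm -> compl_mnm m \in mid_mnm.
Proof.
rewrite !inE !val_compl_mnm lem_subr => /andP[le2 /eqP dm] /=.
rewrite -(eqn_add2r (mdeg m)) -mdegD submK // mdeg_cmnm dm.
by rewrite muln2 addnn.
Qed.

Lemma cmnm1_subproof : (mdeg (cmnm n 1) < (n * 2).+1)%N.
Proof. by rewrite mdeg_cmnm ltnS leq_mul2l orbT. Qed.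

Lemma compl_mnm_fixed m : m \in mid_mnm ->
  (compl_mnm m == m) = (m == BMultinom cmnm1_subproof).
Proof.
rewrite inE => /andP[/mnm_lepP le2 _]; rewrite !bmeqP val_compl_mnm /=.
apply/eqP/eqP => [/mnmP e | ->]; apply/mnmP => i.
  have := e i; have := le2 i; rewrite mnmBE !mnmE.
  by case: (m i) => [|[|[]]].
by rewrite mnmBE !mnmE.
Qed.

(** The complementary exponents m and c(2) - m have degrees adding up to 2 n, and
    both are at most n. *)
Lemma mcoeff_sqr (f : {mpoly F[n]}) : (msize f <= n.+1)%N ->
  (f ^+ 2)@_(cmnm n 2) = \sum_(m in mid_mnm) f@_m * f@_(compl_mnm m).
Proof.
move=> df; have lt : (mdeg (cmnm n 2) < (n * 2).+1)%N by rewrite mdeg_cmnm.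
rewrite expr2 [LHS](mcoeff_poly_mul_lin f f lt) (bigID (fun m : I => mdeg m == n)) /=.
rewrite [X in _ + X]big1 ?addr0 => [|m /andP[le2]]; last first.
  apply: contraNeq; rewrite mulf_eq0 negb_or -!mcoeff_msupp => /andP[mf m'f].
  have dm := leq_trans (msize_mdeg_lt mf) df.
  have dm' := leq_trans (msize_mdeg_lt m'f) df.
  have e : (mdeg (cmnm n 2 - m) + mdeg m = n + n)%N.
    by rewrite -mdegD submK // mdeg_cmnm muln2 addnn.
  by rewrite eqn_leq -ltnS dm /= -(leq_add2l n) -e leq_add2r -ltnS.
by apply: eq_big => [m|m _]; rewrite ?inE ?val_compl_mnm.
Qed.

(** The monomials of the quadratic form have exponents at most 2 < q, so they lie
    in the code and are dual to the coefficients that the form involves. *)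
Lemma card_sqr_zeros : (2 < #|F|)%N -> 2%:R != 0 :> F ->
  #|{: reed_muller F n n}| =
  (#|F| * #|[set f : reed_muller F n n |
             ((val f ^+ 2)@_(cmnm n 2) == 0)%R]|)%N.
Proof.
move=> q3 two_neq0.
pose x (i : I) (f : reed_muller F n n) := (val f)@_i.
pose e (j : I) : reed_muller F n n := insubd 0 'X_[j].
rewrite (@card_quadric F (reed_muller F n n) _ x e compl_mnm
  (BMultinom cmnm1_subproof) two_neq0 mid_mnm) => [|i j v c Si|||| ].
- congr (_ * _)%N; apply: eq_card => f; rewrite !inE mcoeff_sqr //.
  by have /andP[] := valP f.
- rewrite inE => /andP[/mnm_lepP le2 /eqP dj].
  rewrite /x /= mcoeffD mcoeffZ /e val_insubd ifT ?mcoeffX 1?eq_sym //.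
  apply/is_reed_mullerP => m; rewrite msuppX inE => /eqP->; rewrite dj; split=> // k.
  by apply: leq_trans (le2 k) _; rewrite mnmE -ltnS prednK // (ltn_trans _ q3).
- exact: compl_mnm_mid.
- exact: compl_mnmK.
- rewrite inE mdeg_cmnm muln1 eqxx andbT.
  by apply/mnm_lepP => i; rewrite !mnmE.
- exact: compl_mnm_fixed.
Qed.

End Square.

(** * Dimension and cardinality of the code *)

Section Dimension.
Variables (F : finFieldType) (d n : nat).

Lemma dim_rmE : dim_rm F d n = #|@rm_mnm F d n|.
Proof. by rewrite /dim_rm dimvf. Qed.

Lemma card_reed_muller : #|{: reed_muller F d n}| = #|F| ^ dim_rm F d n.
Proof.
rewrite (bij_eq_card (Bijective (@rm_coordK F d n) (@rm_of_coordK F d n))).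
by rewrite card_mx mul1n dim_rmE.
Qed.

Lemma dim_rm_sum : ((dim_rm F d n)%:Z =
  \sum_(0 <= j < (d %/ #|F|).+1)
     (-1) ^+ j * ('C(n, j))%:Z * ('C(n + d - #|F| * j, n))%:Z)%R.
Proof.
have q_gt0 := ltnW (finNzRing_gt1 F).
rewrite dim_rmE -card_bounded_mnm // -cardsE; congr (_%:Z)%R.
apply: eq_card => m; rewrite !inE; apply: eq_forallb => j.
by rewrite -ltnS prednK.
Qed.

End Dimension.

(** * Codewords of weight divisible by 3 *)

Theorem corollary3p5 (F : finFieldType) (m n : nat)
    (hq : #|F| = (3 ^ m)%N) (hm : (1 <= m)%N) (hn : (2 <= n)%N) :
  N_rm F n n 1 = (#|F| ^ (dim_rm F n n - 1))%N /\
  ((dim_rm F n n)%:Z =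
     \sum_(0 <= j < (n %/ #|F|).+1)
       (-1) ^+ j * ('C(n, j))%:Z * ('C(2 * n - #|F| * j, n))%:Z)%R.
Proof.
split; last by rewrite dim_rm_sum addnn mul2n.
have p3 : 3 \in [pchar F]%R by apply: card_finPcharP hq _.
case: m hm hq => // m _ hq.
have q3 : 2 < #|F| by rewrite hq -[3]expn1 leq_exp2l.
have two_neq0 : (2%:R != 0 :> F)%R by rewrite -(dvdn_pcharf p3).
have NE : N_rm F n n 1 =
    #|[set f : reed_muller F n n | ((val f ^+ 2)@_(cmnm n 2) == 0)%R]|.
  apply: eq_card => f; rewrite !inE.
  have /andP[df _] := valP f.
  by rewrite {1}hq pdiv_pfactor // expn1 (dvdn_weight p3 df) hq
    (mcoeff_exp_ppower p3 m df).
have := card_sqr_zeros n q3 two_neq0; rewrite -NE card_reed_muller.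
(* A space of dimension 0 would have q * N = 1 elements, but q >= 3. *)
case: (dim_rm F n n) => [|k]; last first.
  by move/eqP; rewrite expnS eqn_pmul2l ?(ltn_trans _ q3) // subn1 => /eqP.
by move/esym/eqP; rewrite expn0 muln_eq1 => /andP[/eqP q1]; rewrite q1 in q3.
Qed.
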